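(* Consider an $N$-body system. For every planar central configuration $q$ with center of mass $Q=0$ and positive multiplier there exists $p\in\mathbb{R}^{3N}$ such that $(q,p)$ is a critical point of the integral map $\mathcal F$.
   Context: $N$-body system: masses $m_i>0$, configuration space $\mathcal X=\{q\in\mathbb{R}^{3N}: q_i\ne q_j \text{ for } i\neq j\}$, phase space $M=T^*\mathcal X\simeq\mathcal X\times\mathbb{R}^{3N}$, Hamiltonian $H(q,p)=\sum_i\frac{1}{2m_i}\|p_i\|^2+V(q)$, where $V$ is a smooth function of the mutual distances $r_{ij}=\|q_i-q_j\|$, $1\le i<j\le N$, only. Let $m=\sum_i m_i$, $Q=\frac1m\sum_i m_iq_i$, $P=\sum_i p_i$, $L=\sum_i q_i\times p_i$. The integral map is $\mathcal F=(H,L,P,Q):M\to\mathbb{R}^{10}$, and a critical point of $\mathcal F$ is a point at which $D\mathcal F$ does not have full rank $10$. A central configuration is $q\in\mathcal X$ for which there is a multiplier $\lambda\in\mathbb{R}$ with $\frac{\partial V}{\partial q_i}=\lambda m_i(q_i-Q)$ for all $i$. It is planar if all $q_i$ lie in a common plane. *)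

(* Defs.v *)
From HB Require Import structures.
From mathcomp Require Import all_boot all_order all_algebra.
From mathcomp Require Import all_classical all_reals all_analysis.

Set Implicit Arguments.
Unset Strict Implicit.
Unset Printing Implicit Defensive.

Import Order.TTheory GRing.Theory Num.Theory.
Import numFieldNormedType.Exports.

Local Open Scope classical_set_scope.
Local Open Scope ring_scope.

(* [f] is of class C^k on [A]; only meaningful for open [A] in a
   finite-dimensional space, where requiring all directional derivatives to be
   of class C^k.-1 amounts to requiring it of the partial derivatives. *)
Fixpoint Ck_on (R : realType) (E : normedModType R) (k : nat) (A : set E)
    (f : E -> R) : Prop :=
  match k with
  | 0%N => forall x, A x -> {for x, continuous f}
  | k'.+1 => (forall x, A x -> differentiable f x) /\
             (forall v : E, Ck_on k' A (fun x => 'D_v f x))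
  end.

Definition smooth_on (R : realType) (E : normedModType R) (A : set E)
    (f : E -> R) : Prop :=
  forall k, Ck_on k A f.

(* The library norm on matrices is the max norm, hence this definition. *)
Definition enorm (R : realType) (n : nat) (u : 'rV[R]_n) : R :=
  Num.sqrt (\sum_(k < n) u 0 k ^+ 2).

(* Coordinates are indexed by 'I_3, whose addition is modulo 3. *)
Definition crossmul (R : realType) (u v : 'rV[R]_3) : 'rV[R]_3 :=
  \row_(k < 3) (u 0 (k + 1) * v 0 (k + 2%:R) - u 0 (k + 2%:R) * v 0 (k + 1)).

(* An element of R^(3N) is a matrix with N rows: row i is the position (or
   momentum) of body i. A phase point is a pair (q, p) of such matrices. *)
Notation phase R N := ('M[R]_(N, 3) * 'M[R]_(N, 3))%type.

Definition configuration_space (R : realType) (N : nat) : set 'M[R]_(N, 3) :=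
  [set q | forall i j, i != j -> row i q != row j q].

Definition pairs (N : nat) : {set 'I_N * 'I_N} :=
  [set ij : 'I_N * 'I_N | (ij.1 < ij.2)%N]%SET.

(* The vector of the distances r_ij, i < j, in some enumeration of the pairs. *)
Definition mutual_distances (R : realType) (N : nat) (q : 'M[R]_(N, 3)) :
    'rV[R]_#|pairs N| :=
  \row_k enorm (row (enum_val k).1 q - row (enum_val k).2 q).

Definition smooth_function_of_distances (R : realType) (N : nat)
    (V : 'M[R]_(N, 3) -> R) : Prop :=
  exists U : 'rV[R]_#|pairs N| -> R,
    smooth_on [set r : 'rV[R]_#|pairs N| | forall k, 0 < r 0 k] U /\
    forall q, configuration_space q -> V q = U (mutual_distances q).

Section Integrals.
Context (R : realType) (N : nat) (m : 'I_N -> R) (V : 'M[R]_(N, 3) -> R).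

Definition hamiltonian (x : phase R N) : R :=
  \sum_(i < N) (2 * m i)^-1 * enorm (row i x.2) ^+ 2 + V x.1.

Definition angular_momentum (x : phase R N) : 'rV[R]_3 :=
  \sum_(i < N) crossmul (row i x.1) (row i x.2).

Definition linear_momentum (x : phase R N) : 'rV[R]_3 :=
  \sum_(i < N) row i x.2.

Definition center_of_mass (q : 'M[R]_(N, 3)) : 'rV[R]_3 :=
  (\sum_(i < N) m i)^-1 *: \sum_(i < N) m i *: row i q.

Definition integral_map (x : phase R N) : 'rV[R]_10 :=
  row_mx (const_mx (hamiltonian x) : 'rV[R]_1)
    (row_mx (angular_momentum x)
      (row_mx (linear_momentum x) (center_of_mass x.1))).

Definition critical_point (x : phase R N) : Prop :=
  configuration_space x.1 /\ \dim (limg (linfun ('d integral_map x))) <> 10%N.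

Definition gradient (q : 'M[R]_(N, 3)) (i : 'I_N) : 'rV[R]_3 :=
  \row_(k < 3) 'D_(delta_mx i k) V q.

Definition central_configuration (lambda : R) (q : 'M[R]_(N, 3)) : Prop :=
  configuration_space q /\
  forall i, gradient q i = (lambda * m i) *: (row i q - center_of_mass q).

End Integrals.

Definition planar (R : realType) (N : nat) (q : 'M[R]_(N, 3)) : Prop :=
  exists (n : 'rV[R]_3) (c : R),
    n != 0 /\ forall i, \sum_(k < 3) n 0 k * q i k = c.

(* Main.v *)
(* Let the system rotate rigidly about the normal of the plane with angular
   velocity omega, |omega|^2 = lambda, i.e. p_i = m_i omega x q_i. The central
   configuration equation balances the gradient of V against the centrifugal
   term, so that dH = omega . dL at (q, p): the components of the integral map
   have linearly dependent differentials there. *)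
Require Import Defs.
From HB Require Import structures.
From mathcomp Require Import all_boot all_order all_algebra.
From mathcomp Require Import all_classical all_reals all_analysis.
From mathcomp Require Import ring.

Set Implicit Arguments.
Unset Strict Implicit.
Unset Printing Implicit Defensive.

Import Order.TTheory GRing.Theory Num.Theory.
Import numFieldNormedType.Exports.

Local Open Scope classical_set_scope.
Local Open Scope ring_scope.

(** * Differentiability of matrix-valued maps and square roots *)

(** The first-order expansion of [f] at [x] is also one for [g], and uniqueness of the differential
    turns it into differentiability. This serves potentials known only on an open set. *)
Lemma near_eq_differentiable (R : numFieldType) (E F : normedModType R)
    (f g : E -> F) (x : E) :
  {near x, f =1 g} -> differentiable f x -> differentiable g x.
Proof.
move=> fg /diff_locallyP[df_cont df].
have dg : g \o shift x = cst (g x) + 'd f x +o_ 0 id.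
  have fgx : f x = g x by exact: nbhs_singleton fg.
  apply/eqaddoP => _/posnumP[e].
  have /eqaddoP/(_ e%:num)/(_ [gt0 of e%:num]) := df.
  (* The neighbourhood of [x] is translated to one of 0, where the increment [h] lives. *)
  have : \forall h \near 0, f (h + x) = g (h + x).
    by have := fg; rewrite (near_shift 0); apply: filterS => h /=; rewrite subr0.
  by apply: filterS2 => h fgh; rewrite /= !fctE /= -fgh -fgx.
by apply/diff_locallyP; rewrite (diff_unique df_cont dg).
Qed.

Section MatrixValued.
Context (R : realFieldType) (E : normedModType R).

Lemma differentiable_mx (a b : nat) (f : E -> 'M[R]_(a, b)) (x : E) :
  (forall i j, differentiable (fun y => f y i j) x) -> differentiable f x.
Proof.
move=> df.
have -> : f = \sum_(i < a) \sum_(j < b) (fun y => f y i j *: delta_mx i j).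
  apply/funext => y; rewrite [LHS]matrix_sum_delta fct_sumE.
  by apply: eq_bigr => i _; rewrite fct_sumE.
apply: differentiable_sum => i; apply: differentiable_sum => j.
exact: differentiableZl.
Qed.

Lemma differentiable_entry (a b : nat) (f : E -> 'M[R]_(a, b)) (x : E) i j :
  differentiable f x -> differentiable (fun y => f y i j) x.
Proof.
move=> df; apply: (@differentiable_comp _ _ _ _ f (fun M => M i j)) => //.
exact: differentiable_coord.
Qed.

Lemma differentiable_row_mx (a b c : nat) (f : E -> 'M[R]_(a, b))
    (g : E -> 'M[R]_(a, c)) (x : E) :
  differentiable f x -> differentiable g x ->
  differentiable (fun y => row_mx (f y) (g y)) x.
Proof.
move=> df dg; apply: differentiable_mx => i j.
under eq_fun do rewrite mxE.
by case: (fintype.split j) => k; exact: differentiable_entry.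
Qed.

Lemma derive_entry (a b : nat) (f : E -> 'M[R]_(a, b)) (x v : E) i j :
  differentiable f x -> 'D_v (fun y => f y i j) x = 'D_v f x i j.
Proof.
by move=> df; rewrite derive_mx ?mxE//; exact: diff_derivable.
Qed.

End MatrixValued.

Lemma differentiable_sqrt (R : realType) (E : normedModType R) (f : E -> R)
    (x : E) :
  0 < f x -> differentiable f x -> differentiable (fun y => Num.sqrt (f y)) x.
Proof.
move=> fx0 df; apply: (differentiable_comp df).
by apply/derivable1_diffP; case: (is_derive1_sqrt fx0).
Qed.

Lemma enormE2 (R : realType) (n : nat) (u : 'rV[R]_n) :
  enorm u ^+ 2 = \sum_(k < n) u 0 k ^+ 2.
Proof. by rewrite sqr_sqrtr// sumr_ge0// => k _; exact: sqr_ge0. Qed.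

Lemma sum_sqr_gt0 (R : realType) (n : nat) (u : 'rV[R]_n) :
  u != 0 -> 0 < \sum_(k < n) u 0 k ^+ 2.
Proof.
move=> u0; rewrite lt_neqAle sumr_ge0 ?andbT => [|k _]; last exact: sqr_ge0.
apply: contra u0; rewrite eq_sym psumr_eq0 => [/allP u0|k _]; last exact: sqr_ge0.
apply/eqP/rowP => k; rewrite mxE; apply/eqP.
by have := u0 k (mem_index_enum k); rewrite sqrf_eq0.
Qed.

(** * Mutual distances and differentiability of the potential *)

Section Distances.
Context (R : realType) (N : nat).
Implicit Types q : 'M[R]_(N, 3).

(** Two distinct bodies differ in some coordinate; that difference is continuous, hence stays
    nonzero nearby. Only finitely many pairs have to be treated. *)
Lemma near_configuration_space q :
  configuration_space q -> \forall q' \near q, configuration_space q'.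
Proof.
move=> hq.
(* The condition [ij.1 != ij.2] sits inside the filter, so that the finite intersection can run over
   all pairs. *)
have sep (ij : 'I_N * 'I_N) :
    \forall q' \near q, ij.1 != ij.2 -> row ij.1 q' != row ij.2 q'.
  have [eij|nij] := eqVneq ij.1 ij.2; first by near=> q'.
  have /existsP[k qk] : [exists k, q ij.1 k != q ij.2 k].
    rewrite -negb_forall; apply: contra (hq _ _ nij) => /forallP e.
    by apply/eqP/rowP => k; rewrite !mxE; exact/eqP.
  pose d (q' : 'M[R]_(N, 3)) := q' ij.1 k - q' ij.2 k.
  have dq : {for q, continuous d}.
    apply: differentiable_continuous.
    by apply: differentiableB; exact: differentiable_coord.
  near=> q' => _; have : d q' != 0.
    by near: q'; apply: (cvgr_neq0 _ dq); rewrite /d subr_eq0.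
  move=> /eqP dq'; apply/eqP => /rowP/(_ k); rewrite !mxE => e; apply: dq'.
  by rewrite /d e subrr.
near=> q'.
have h : forall ij : 'I_N * 'I_N, ij.1 != ij.2 -> row ij.1 q' != row ij.2 q'.
  by near: q'; exact: filter_forall.
by move=> i j; exact: (h (i, j)).
Unshelve. all: by end_near. Qed.

(** Away from collisions every radicand is positive, so the square root is differentiable there. *)
Lemma differentiable_mutual_distances q :
  configuration_space q -> differentiable (@mutual_distances R N) q.
Proof.
move=> hq; apply: differentiable_mx => i k.
have -> : (fun q' => mutual_distances q' i k) = fun q' => Num.sqrt
    ((\sum_(l < 3) (fun q' : 'M[R]_(N, 3) =>
       q' (enum_val k).1 l - q' (enum_val k).2 l) ^+ 2) q').
  apply/funext => q'; rewrite mxE /enorm fct_sumE; congr Num.sqrt.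
  by apply: eq_bigr => l _; rewrite !mxE.
have := enum_valP k; rewrite inE => kP.
apply: differentiable_sqrt.
  have /sum_sqr_gt0 : row (enum_val k).1 q - row (enum_val k).2 q != 0.
    by rewrite subr_eq0 hq// -val_eqE neq_ltn kP.
  by under eq_bigr do rewrite !mxE; rewrite fct_sumE.
apply: differentiable_sum => l; apply: differentiableX.
by apply: differentiableB; exact: differentiable_coord.
Qed.

(** [V] agrees with a smooth function of the distances only off collisions, but that set is open and
    differentiability is local. *)
Lemma differentiable_potential (V : 'M[R]_(N, 3) -> R) q :
  smooth_function_of_distances V -> configuration_space q -> differentiable V q.
Proof.
move=> [U [/(_ 1%N)[dU _] VU]] hq.
apply: (@near_eq_differentiable _ _ _ (U \o @mutual_distances R N)).
  by near do apply/esym/VU; exact: near_configuration_space.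
apply: differentiable_comp; first exact: differentiable_mutual_distances.
apply: dU => k /=; rewrite mxE sqrtr_gt0; apply: sum_sqr_gt0.
by have := enum_valP k; rewrite inE subr_eq0 => kP; rewrite hq// -val_eqE neq_ltn kP.
Unshelve. all: by end_near. Qed.

End Distances.

(** * Sums over three coordinates; differentials of projections and coordinates *)

(** Produces the indices in the form to which the modulo 3 arithmetic of [crossmul] reduces. *)
Lemma sum3E (A : nmodType) (F : 'I_3 -> A) :
  \sum_k F k = F 0 + F 1 + F 2%:R.
Proof.
rewrite !big_ord_recl big_ord0 addr0 addrA.
by congr (F _ + F _ + F _); exact: val_inj.
Qed.

Section IsDiff.
Context (R : realType) (E F : normedModType R).

Lemma is_diff_is_derive (f df : E -> F) (x v : E) :
  is_diff x f df -> is_derive x v f (df v).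
Proof.
move=> [dfx dfE]; apply: DeriveDef; first exact: diff_derivable.
by rewrite deriveE// dfE.
Qed.

Lemma is_diff_fst (x : E * F) : is_diff x (@fst E F) fst.
Proof.
have c : continuous (@fst E F) by move=> y; exact: cvg_fst.
by apply: DiffDef; [exact: linear_differentiable|rewrite diff_lin].
Qed.

Lemma is_diff_snd (x : E * F) : is_diff x (@snd E F) snd.
Proof.
have c : continuous (@snd E F) by move=> y; exact: cvg_snd.
by apply: DiffDef; [exact: linear_differentiable|rewrite diff_lin].
Qed.

End IsDiff.

Lemma is_diff_coord (R : realType) (a b : nat) (M : 'M[R]_(a, b)) i j :
  is_diff M (fun A : 'M[R]_(a, b) => A i j) (fun A => A i j).
Proof.
apply: DiffDef; first exact: differentiable_coord.
apply/funext => A; rewrite -deriveE; last exact: differentiable_coord.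
by rewrite (@derive_entry _ _ _ _ id)// derive_id.
Qed.

(** * The integrals on phase space: derivatives and rank *)

Section PhaseSpace.
Context (R : realType) (N : nat) (m : 'I_N -> R) (V : 'M[R]_(N, 3) -> R).
Implicit Types x v : phase R N.

(** Named coordinate functions, so that the instances below let derivatives of polynomials in them
    be found by inference. *)
Definition position i k x : R := x.1 i k.
Definition momentum i k x : R := x.2 i k.

#[local] Instance is_diff_position x i k : is_diff x (position i k) (position i k).
Proof.
exact: (is_diff_comp (is_diff_fst x) (is_diff_coord x.1 i k)).
Qed.

#[local] Instance is_derive_position x v i k :
  is_derive x v (position i k) (v.1 i k).
Proof. exact: (is_diff_is_derive v (is_diff_position x i k)). Qed.

#[local] Instance is_diff_momentum x i k : is_diff x (momentum i k) (momentum i k).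
Proof.
exact: (is_diff_comp (is_diff_snd x) (is_diff_coord x.2 i k)).
Qed.

#[local] Instance is_derive_momentum x v i k :
  is_derive x v (momentum i k) (v.2 i k).
Proof. exact: (is_diff_is_derive v (is_diff_momentum x i k)). Qed.

Lemma differential_gradient (q u : 'M[R]_(N, 3)) :
  differentiable V q ->
  'd V q u = \sum_(i < N) \sum_(k < 3) u i k * gradient V q i 0 k.
Proof.
move=> dV; rewrite [in LHS](matrix_sum_delta u) linear_sum.
apply: eq_bigr => i _; rewrite linear_sum; apply: eq_bigr => k _.
by rewrite linearZ mxE deriveE.
Qed.

Lemma is_diff_potential x :
  differentiable V x.1 ->
  is_diff x (fun y : phase R N => V y.1) (fun v => 'd V (x.1) v.1).
Proof.
by move=> dV; exact: (is_diff_comp (is_diff_fst x) (differentiableP dV)).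
Qed.

(** A point-free form in the coordinate functions, to which the differentiation rules apply. *)
Lemma hamiltonianE : hamiltonian m V =
  \sum_(i < N) (2 * m i)^-1 *:
     (\sum_(k < 3) momentum i k ^+ 2) + (fun y => V y.1).
Proof.
apply/funext => x; rewrite /hamiltonian; congr (_ + _); rewrite fct_sumE.
apply: eq_bigr => i _; rewrite enormE2 /GRing.scale /= fct_sumE; congr (_ * _).
by apply: eq_bigr => k _; rewrite mxE.
Qed.

Lemma angular_momentumE k :
  (fun x : phase R N => angular_momentum x 0 k) =
  \sum_(i < N) (position i (k + 1) * momentum i (k + 2%:R) -
                position i (k + 2%:R) * momentum i (k + 1)).
Proof.
apply/funext => x; rewrite summxE fct_sumE.
by apply: eq_bigr => i _; rewrite !mxE.
Qed.

Lemma is_derive_angular_momentum x v k :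
  is_derive x v (fun y : phase R N => angular_momentum y 0 k)
    (\sum_(i < N) (x.1 i (k + 1) * v.2 i (k + 2%:R) +
                   x.2 i (k + 2%:R) * v.1 i (k + 1) -
                  (x.1 i (k + 2%:R) * v.2 i (k + 1) +
                   x.2 i (k + 1) * v.1 i (k + 2%:R)))).
Proof.
rewrite angular_momentumE; apply: is_derive_sum => i.
by apply: is_deriveB; apply: is_deriveM;
  (exact: is_derive_position || exact: is_derive_momentum).
Qed.

Lemma is_derive_hamiltonian x v :
  differentiable V x.1 ->
  is_derive x v (hamiltonian m V)
    (\sum_(i < N) \sum_(k < 3)
       ((m i)^-1 * x.2 i k * v.2 i k + v.1 i k * gradient V x.1 i 0 k)).
Proof.
move=> dV; rewrite hamiltonianE.
have dVx : is_derive x v (fun y : phase R N => V y.1) ('d V (x.1) v.1).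
  exact: (is_diff_is_derive v (is_diff_potential dV)).
apply: is_derive_eq.
rewrite differential_gradient// -big_split; apply: eq_bigr => i _.
rewrite scaler_sumr -big_split; apply: eq_bigr => k _ /=.
rewrite expr1 /GRing.scale /= /momentum.
(* The masses are arbitrary here; for [m i = 0] both kinetic coefficients vanish, since the inverse
   of 0 is 0. *)
have [->|m0] := eqVneq (m i) 0; first by rewrite mulr0 invr0 !mul0r.
by congr (_ + _); field.
Qed.

Lemma differentiable_hamiltonian x :
  differentiable V x.1 -> differentiable (hamiltonian m V) x.
Proof.
move=> dV; rewrite hamiltonianE; apply: differentiableD.
  apply: differentiable_sum => i; apply: differentiableZ.
  apply: differentiable_sum => k; apply: differentiableX.
  exact: ex_diff.
by have [] := is_diff_potential dV.
Qed.

Lemma differentiable_angular_momentum x :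
  differentiable (@angular_momentum R N) x.
Proof.
apply: differentiable_mx => i k; rewrite ord1 angular_momentumE.
apply: differentiable_sum => j.
by apply: differentiableB; apply: differentiableM;
  exact: ex_diff.
Qed.

Lemma differentiable_linear_momentum x :
  differentiable (@linear_momentum R N) x.
Proof.
apply: differentiable_mx => i k.
have -> : (fun y => linear_momentum y i k) =
    \sum_(j < N) momentum j k.
  apply/funext => y; rewrite summxE fct_sumE.
  by apply: eq_bigr => j _; rewrite mxE.
by apply: differentiable_sum => j; exact: ex_diff.
Qed.

Lemma differentiable_center_of_mass x :
  differentiable (fun y : phase R N => center_of_mass m y.1) x.
Proof.
apply: differentiable_mx => i k.
have -> : (fun y : phase R N => center_of_mass m y.1 i k) =
    (\sum_(j < N) m j)^-1 *: \sum_(j < N) m j *: position j k.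
  apply/funext => y; rewrite mxE summxE /GRing.scale /= fct_sumE.
  by congr (_ * _); apply: eq_bigr => j _; rewrite !mxE.
apply: differentiableZ; apply: differentiable_sum => j; apply: differentiableZ.
exact: ex_diff.
Qed.

Lemma differentiable_integral_map x :
  differentiable V x.1 -> differentiable (integral_map m V) x.
Proof.
(* The explicit sizes split 10 as 1 + 9, then 9 as 3 + 6 and 6 as 3 + 3. *)
move=> dV; apply: (@differentiable_row_mx _ _ 1 1 9).
  apply: differentiable_mx => i k.
  under eq_fun do rewrite mxE.
  exact: differentiable_hamiltonian.
apply: (@differentiable_row_mx _ _ 1 3 6).
  exact: differentiable_angular_momentum.
apply: (@differentiable_row_mx _ _ 1 3 3).
  exact: differentiable_linear_momentum.
exact: differentiable_center_of_mass.
Qed.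

(* A relation [dH = \sum_k omega_k dL_k] is a nonzero covector annihilating the
   image of the differential of the integral map. *)
Lemma rank_integral_map x (omega : 'rV[R]_3) :
  differentiable V x.1 ->
  (forall v, 'D_v (hamiltonian m V) x =
     \sum_(k < 3) omega 0 k * 'D_v (fun y => angular_momentum y 0 k) x) ->
  \dim (limg (linfun ('d (integral_map m V) x))) <> 10%N.
Proof.
move=> dV dHL dim10.
have full : limg (linfun ('d (integral_map m V) x)) = fullv.
  by apply/eqP; rewrite eqEdim subvf dim10 dimvf.
have dF := differentiable_integral_map dV.
pose j0 : 'I_10 := @lshift 1 9 0.
(* Surjectivity yields a direction [v] along which the energy has derivative 1 and all other
   integrals have derivative 0; the relation then reads 1 = 0. *)
have := memvf (delta_mx 0 j0 : 'rV[R]_10); rewrite -full => /memv_imgP[v _].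
rewrite lfunE /= -deriveE// => Dv.
have H1 : 'D_v (hamiltonian m V) x = 1.
  have -> : hamiltonian m V = fun y => integral_map m V y 0 j0.
    by apply/funext => y; rewrite [RHS](@row_mxEl _ 1 1 9) mxE.
  by rewrite derive_entry// -Dv mxE !eqxx.
have L0 k : 'D_v (fun y => angular_momentum y 0 k) x = 0.
  pose j : 'I_10 := @rshift 1 9 (@lshift 3 6 k).
  have -> : (fun y => angular_momentum y 0 k) = fun y => integral_map m V y 0 j.
    by apply/funext => y; rewrite [RHS](@row_mxEr _ 1 1 9) (@row_mxEl _ 1 3 6).
  by rewrite derive_entry// -Dv mxE.
have := dHL v; rewrite H1 big1 => [/eqP|k _]; first by rewrite oner_eq0.
by rewrite L0 mulr0.
Qed.

(** * The rigid rotation *)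

Definition rotation_momentum (omega : 'rV[R]_3) (q : 'M[R]_(N, 3)) :
    'M[R]_(N, 3) :=
  \matrix_(i < N) (m i *: crossmul omega (row i q)).

(* With [p_i = m_i omega * q_i] and [omega] orthogonal to [q_i], the
   double cross product [p_i * omega] is [m_i |omega|^2 q_i], which the
   central configuration equation identifies with the gradient of [V]. *)
Lemma derive_hamiltonian_rotation (omega : 'rV[R]_3) (q : 'M[R]_(N, 3)) v :
  (forall i, 0 < m i) -> differentiable V q ->
  (forall i, gradient V q i = (enorm omega ^+ 2 * m i) *: row i q) ->
  (forall i, \sum_(k < 3) omega 0 k * q i k = 0) ->
  'D_v (hamiltonian m V) (q, rotation_momentum omega q) =
  \sum_(k < 3) omega 0 k *
    'D_v (fun y => angular_momentum y 0 k) (q, rotation_momentum omega q).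
Proof.
move=> hm dV hgrad horth.
have e1 : 1 + 1 = 2%:R :> 'I_3 by exact: val_inj.
have e2 : 1 + 2%:R = 0 :> 'I_3 by exact: val_inj.
have e3 : 2%:R + 1 = 0 :> 'I_3 by exact: val_inj.
have e4 : 2%:R + 2%:R = 1 :> 'I_3 by exact: val_inj.
rewrite (@derive_val _ _ _ _ _ _ _ (@is_derive_hamiltonian (q, _) v dV)).
under [RHS]eq_bigr do
  rewrite (@derive_val _ _ _ _ _ _ _ (is_derive_angular_momentum _ _ _)) mulr_sumr.
(* With the sum over bodies outermost, the identity is checked body by body. *)
rewrite [RHS]exchange_big; apply: eq_bigr => i _ /=.
under eq_bigr do rewrite hgrad.
rewrite !sum3E !mxE !(add0r, e1, e2, e3, e4) enormE2 sum3E.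
have := horth i; rewrite sum3E => orth.
(* Writing u_i for row i of [v.1], the double cross product leaves the right side short by m_i
   (omega . u_i)(omega . q_i). This term is 0 by orthogonality; adding it makes the identity purely
   algebraic. *)
rewrite -[RHS]addr0 -(mulr0 (m i * (omega 0 0 * v.1 i 0 +
  omega 0 1 * v.1 i 1 + omega 0 2%:R * v.1 i 2%:R))) -orth.
have m0 : m i != 0 by rewrite gt_eqF.
by field.
Qed.

End PhaseSpace.

(** * Planar central configurations *)

Theorem corollary3p7 (R : realType) (N : nat) (m : 'I_N -> R)
    (V : 'M[R]_(N, 3) -> R)
    (hm : forall i, 0 < m i)
    (hV : smooth_function_of_distances V)
    (q : 'M[R]_(N, 3)) (lambda : R)
    (hq : central_configuration m V lambda q)
    (hplanar : planar q)
    (hQ : center_of_mass m q = 0)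
    (hlambda : 0 < lambda) :
  exists p : 'M[R]_(N, 3), critical_point m V (q, p).
Proof.
have [hX hgrad] := hq; have [n [c [n0 hn]]] := hplanar.
have dV := differentiable_potential hV hX.
have n2 := sum_sqr_gt0 n0.
(* The normal of the plane, rescaled to have squared length [lambda]; this is where [lambda] must be
   positive. *)
pose omega := (Num.sqrt lambda / enorm n) *: n.
have omega2 : enorm omega ^+ 2 = lambda.
  rewrite enormE2; under eq_bigr do rewrite mxE exprMn.
  rewrite -mulr_sumr exprMn exprVn enormE2 sqr_sqrtr ?ltW//.
  by rewrite mulfVK// gt_eqF.
(* Weighting n . q_i = c by the masses and summing gives (sum of m_j) c = n . 0 = 0, so c = 0: the
   plane passes through the center of mass, the origin. *)
have orth i : \sum_(k < 3) omega 0 k * q i k = 0.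
  under eq_bigr do rewrite mxE -mulrA.
  rewrite -mulr_sumr hn.
  (* Body [i] makes the sum nonempty, hence the total mass positive. *)
  have mass : 0 < \sum_(j < N) m j.
    rewrite (bigD1 i)//= ltr_wpDr// sumr_ge0// => j _; exact: ltW.
  have mq0 : \sum_(j < N) m j *: row j q = 0.
    move/eqP: hQ; rewrite /center_of_mass scaler_eq0 invr_eq0 gt_eqF//=.
    by move/eqP.
  have /eqP : (\sum_(j < N) m j) * c = 0.
    transitivity (\sum_(k < 3) n 0 k * (\sum_(j < N) m j *: row j q) 0 k).
      rewrite mulr_suml; under [RHS]eq_bigr do rewrite summxE mulr_sumr.
      rewrite exchange_big; apply: eq_bigr => j _ /=.
      rewrite -(hn j) mulr_sumr; apply: eq_bigr => k _.
      by rewrite !mxE mulrCA.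
    by rewrite mq0 big1// => k _; rewrite mxE mulr0.
  by rewrite mulf_eq0 gt_eqF//= => /eqP ->; rewrite mulr0.
exists (rotation_momentum m omega q); split => //.
apply: (rank_integral_map (omega := omega)) => // v.
apply: derive_hamiltonian_rotation => // i.
by rewrite hgrad hQ subr0 omega2.
Qed.
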